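(* Consider a given room, i.e. a finite arrangement of walls (flat surfaces, which may include ceilings, floors and sloping walls) in $\mathbb R^3$, and a loudspeaker at a given position. Let $\mathcal S\subset\mathbb R^3$ be the finite set of mirror points, i.e. the points obtained by reflecting the loudspeaker position at the (planes containing the) walls. Five microphones are positioned at $\mathbf a_1,\dots,\mathbf a_5\in\mathbb R^3$. Then almost all microphone positions $(\mathbf a_1,\dots,\mathbf a_5)\in(\mathbb R^3)^5$ are good, meaning the following: the set of all $(\mathbf a_1,\dots,\mathbf a_5)$ that are not good is contained in a subvariety of $(\mathbb R^3)^5$ of dimension less than $15$, where $(\mathbf a_1,\dots,\mathbf a_5)$ is called good if from a single sound emitted by the loudspeaker at a (to the microphones unknown) time $t_0$, the detection algorithm described in the context detects all walls from which an echo is received by every microphone, but detects no ghost walls. Explicitly: if $\mathcal S_i\subseteq\mathcal S$ (which may depend on $(\mathbf a_1,\dots,\mathbf a_5)$) denotes the set of mirror points belonging to walls from which an echo is received by the $i$th microphone, and if the algorithm is run with the microphone positions $\mathbf a_1,\dots,\mathbf a_5$ and the input sets $\mathcal T_i=\{t_0+\lVert\mathbf s-\mathbf a_i\rVert : \mathbf s\in\mathcal S_i\}$ for $i=1,\dots,5$, then its output $\mathcal E$ contains $(t_0,\mathbf s)$ for every $\mathbf s\in\mathcal S_1\cap\cdots\cap\mathcal S_5$, and every $(t,\mathbf x)\in\mathcal E$ satisfies $\mathbf x\in\mathcal S$.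
   Context: Units are such that sound travels with speed $1$; $\lVert\cdot\rVert$ is the Euclidean norm. A subvariety of $(\mathbb R^3)^5$ is the zero set of a collection of real polynomials in the $15$ coordinates. In the ray acoustics approximation used here, an echo from a wall is received as if it had been emitted from the corresponding mirror point at the time $t_0$ of the sound emission. A wall is detected when the algorithm outputs its mirror point; a ghost wall is a detected wall that is not really there, i.e. one corresponding to an output position $\mathbf x\notin\mathcal S$. Whether a position is good does not depend on $t_0$. Detection algorithm. Input: positions $\mathbf a_1,\dots,\mathbf a_5\in\mathbb R^3$ and finite sets $\mathcal T_1,\dots,\mathcal T_5\subset\mathbb R$ ($\mathcal T_i$ contains the times when the $i$th microphone received a signal). Start with $\mathcal E:=\emptyset$. For each $(t_1,\dots,t_5)\in\mathcal T_1\times\cdots\times\mathcal T_5$, form the matrix $$D=\bigl((t_i-t_j)^2-\lVert\mathbf a_i-\mathbf a_j\rVert^2\bigr)_{i,j=1,\dots,5}.$$ If $\det(D)=0$, compute an emission time $t$ and a source position $\mathbf x$ as follows and include $(t,\mathbf x)$ in $\mathcal E$. Let $$A=\begin{pmatrix}-2t_1&2\mathbf a_1^T&-1\\ \vdots&\vdots&\vdots\\ -2t_5&2\mathbf a_5^T&-1\end{pmatrix}\in\mathbb R^{5\times5},\quad \tilde A=\begin{pmatrix}2\mathbf a_1^T&-1\\ \vdots&\vdots\\ 2\mathbf a_5^T&-1\end{pmatrix}\in\mathbb R^{5\times4},\quad \mathbf w=\begin{pmatrix}\lVert\mathbf a_1\rVert^2-t_1^2\\ \vdots\\ \lVert\mathbf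 a_5\rVert^2-t_5^2\end{pmatrix}.$$ (i) If $\operatorname{rank}(A)=5$, then $\begin{pmatrix}t\\ \mathbf x\end{pmatrix}$ consists of the first four entries of $A^{-1}\mathbf w$. (ii) If $\operatorname{rank}(A)\le4$ and $\mathbf a_1,\dots,\mathbf a_5$ are not coplanar, put $\tilde B=(\tilde A^T\tilde A)^{-1}\tilde A^T$, $\begin{pmatrix}\mathbf u\\ \alpha\end{pmatrix}=2\tilde B(t_1,\dots,t_5)^T$, $\begin{pmatrix}\mathbf v\\ \beta\end{pmatrix}=\tilde B\mathbf w$ (with $\mathbf u,\mathbf v\in\mathbb R^3$, $\alpha,\beta\in\mathbb R$), and take the solutions $(t,\mathbf x)$ of $\mathbf x=t\mathbf u+\mathbf v$, $(\lVert\mathbf u\rVert^2-1)t^2+(2\mathbf u^T\mathbf v-\alpha)t+\lVert\mathbf v\rVert^2-\beta=0$. If there are two solutions, a solution with $t_i<t$ for some $i$ is discarded as spurious; if neither can be discarded, both are included in $\mathcal E$. (If $\operatorname{rank}(A)\le 4$ and the $\mathbf a_i$ are coplanar, the step is not specified; a position for which this case arises is not counted as good.) After all quintuples have been treated, output $\mathcal E$. *)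

(* Defs.v *)
From HB Require Import structures.
From mathcomp Require Import all_boot all_order all_algebra.
From mathcomp Require Import mpoly.
From mathcomp Require Import boolp classical_sets cardinality.
From mathcomp Require Import reals constructive_ereal ereal.

Set Implicit Arguments.
Unset Strict Implicit.
Unset Printing Implicit Defensive.

Import Order.TTheory GRing.Theory Num.Theory.

Local Open Scope classical_set_scope.
Local Open Scope ring_scope.

Section Varieties.
Variables (R : realType) (n : nat).

Definition zero_locus (P : set {mpoly R[n]}) : set 'rV[R]_n :=
  [set x | forall p, P p -> p.@[fun k => x ord0 k] = 0].

Definition subvariety (V : set 'rV[R]_n) : Prop :=
  exists P : set {mpoly R[n]}, V = zero_locus P.

Definition irreducible_subvariety (X : set 'rV[R]_n) : Prop :=
  [/\ subvariety X, X !=set0 &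
      forall Y Z, subvariety Y -> subvariety Z ->
        X = Y `|` Z -> X = Y \/ X = Z].

(* X 0 < X 1 < ... < X k, a chain of length k; the values of X beyond k are
   irrelevant. *)
Definition irreducible_chain (V : set 'rV[R]_n) (k : nat)
    (X : nat -> set 'rV[R]_n) : Prop :=
  (forall i, (i <= k)%N -> irreducible_subvariety (X i) /\ X i `<=` V) /\
  (forall i, (i < k)%N -> X i `<` X i.+1).

(* Krull dimension for the Zariski topology; it is -oo for the empty set. *)
Definition dimension (V : set 'rV[R]_n) : \bar R :=
  ereal_sup [set (k%:R)%:E | k in [set k | exists X, irreducible_chain V k X]].

End Varieties.

Section Euclidean.
Variable R : realType.

Definition dot (u v : 'rV[R]_3) : R := (u *m v^T) ord0 ord0.

(* The library norm on matrices is the sup norm. *)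
Definition enorm (u : 'rV[R]_3) : R := Num.sqrt (dot u u).

Definition plane (nrm : 'rV[R]_3) (d : R) : set 'rV[R]_3 :=
  [set x | dot nrm x = d].

Definition coplanar (a : 'M[R]_(5, 3)) : Prop :=
  exists nrm d, nrm != 0 /\ forall i, plane nrm d (row i a).

Record wall := Wall {
  wall_normal : 'rV[R]_3;
  wall_offset : R;
  wall_surface : set 'rV[R]_3;
  wall_normal_neq0 : wall_normal != 0;
  wall_flat : wall_surface `<=` plane wall_normal wall_offset
}.

Definition mirror_point (l : 'rV[R]_3) (w : wall) : 'rV[R]_3 :=
  l - (2 * (dot (wall_normal w) l - wall_offset w)
         / dot (wall_normal w) (wall_normal w)) *: wall_normal w.

End Euclidean.

(* Row i of a : 'M_(5, 3) is the position of the i-th microphone, and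
   t : 'cV_5 is a tuple of reception times. *)
Section Algorithm.
Variable R : realType.
Implicit Types (a : 'M[R]_(5, 3)) (t : 'cV[R]_5) (T : 'I_5 -> set R).

Definition matD a t : 'M[R]_5 :=
  \matrix_(i, j) ((t i ord0 - t j ord0) ^+ 2 - enorm (row i a - row j a) ^+ 2).

Definition mattA a : 'M[R]_(5, 3 + 1) := row_mx (2 *: a) (const_mx (-1)).

Definition matA a t : 'M[R]_5 := row_mx (- 2 *: t) (mattA a) : 'M_(5, 1 + (3 + 1)).

Definition vecw a t : 'cV[R]_5 :=
  \col_i (enorm (row i a) ^+ 2 - t i ord0 ^+ 2).

Definition matB a : 'M[R]_(3 + 1, 5) :=
  invmx ((mattA a)^T *m mattA a) *m (mattA a)^T.

Definition linear_solution a t : R * 'rV[R]_3 :=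
  let z : 'cV[R]_(1 + (3 + 1)) := invmx (matA a t) *m vecw a t in
  (usubmx z ord0 ord0, (usubmx (dsubmx z))^T).

Definition quadratic_solutions a t : set (R * 'rV[R]_3) :=
  let ualpha := 2 *: (matB a *m t) in
  let vbeta := matB a *m vecw a t in
  let u := (usubmx ualpha)^T in let alpha := dsubmx ualpha ord0 ord0 in
  let v := (usubmx vbeta)^T in let beta := dsubmx vbeta ord0 ord0 in
  [set e | e.2 = e.1 *: u + v /\
    (enorm u ^+ 2 - 1) * e.1 ^+ 2 + (2 * dot u v - alpha) * e.1
      + enorm v ^+ 2 - beta = 0].

Definition kept_solutions a t : set (R * 'rV[R]_3) :=
  [set e | quadratic_solutions a t e /\
    ((quadratic_solutions a t #= `I_2)%card ->
       ~ exists i, t i ord0 < e.1)].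

Definition step_output a t : set (R * 'rV[R]_3) :=
  [set e | (\rank (matA a t) = 5%N /\ e = linear_solution a t) \/
           [/\ (\rank (matA a t) <= 4)%N, ~ coplanar a & kept_solutions a t e]].

Definition algorithm_output a T : set (R * 'rV[R]_3) :=
  [set e | exists t, [/\ forall i, T i (t i ord0), \det (matD a t) = 0 &
                         step_output a t e]].

Definition step_unspecified a T : Prop :=
  exists t, [/\ forall i, T i (t i ord0), \det (matD a t) = 0,
                (\rank (matA a t) <= 4)%N & coplanar a].

End Algorithm.

Section Room.
Variables (R : realType) (nw : nat) (walls : 'I_nw -> wall R).
Variable speaker : 'rV[R]_3.

Definition mirror_points : set 'rV[R]_3 :=
  range (fun k => mirror_point speaker (walls k)).

(* hears a i is the set of walls from which the i-th microphone receives an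
   echo when the microphones are at a. *)
Variable hears : 'M[R]_(5, 3) -> 'I_5 -> set 'I_nw.

Definition heard_points (a : 'M[R]_(5, 3)) (i : 'I_5) : set 'rV[R]_3 :=
  [set mirror_point speaker (walls k) | k in hears a i].

Definition reception_times (t0 : R) (a : 'M[R]_(5, 3)) (i : 'I_5) : set R :=
  [set t0 + enorm (s - row i a) | s in heard_points a i].

Definition good (a : 'M[R]_(5, 3)) : Prop :=
  forall t0 : R, let T := reception_times t0 a in
  [/\ ~ step_unspecified a T,
      forall s, (forall i, heard_points a i s) -> algorithm_output a T (t0, s) &
      forall t x, algorithm_output a T (t, x) -> mirror_points x].

End Room.

(* Main.v *)
(* Let r i be the distance from microphone i to the mirror point s i that caused
   its echo. If all s i equal s and matA is invertible, the algorithm computes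
   (t0, s); so it suffices that, outside a hypersurface, \det (matA a r) != 0
   for constant tuples s and \det (matD a r) != 0 for nonconstant ones. Both
   determinants are polynomials in the coordinates of a and in the square roots
   r i. Multiplying the conjugates under r i |-> - r i gives a polynomial in a
   alone, which is nonzero as soon as some a makes the determinant nonzero for
   all choices of signs of the r i; explicit such positions a are given. The
   product over all tuples of mirror points defines the hypersurface. *)
Require Import Defs.
From mathcomp Require Import all_boot all_order all_algebra all_fingroup.
From mathcomp Require Import mpoly.
From mathcomp Require Import boolp classical_sets cardinality.
From mathcomp Require Import reals constructive_ereal ereal.
From mathcomp Require Import ring lra zify.

Set Implicit Arguments.
Unset Strict Implicit.
Import Order.TTheory GRing.Theory Num.Theory.

Local Open Scope classical_set_scope.
Local Open Scope ring_scope.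

(** * Krull dimension *)

Section KrullDimension.

Definition prime_ideal (A : comNzRingType) (J : A -> Prop) : Prop :=
  [/\ J 0, forall p q, J p -> J q -> J (p - q), forall p q, J q -> J (p * q),
      ~ J 1 & forall p q, J (p * q) -> J p \/ J q].

Variables (F : fieldType) (n : nat).
Implicit Types (J : {mpoly F[n]} -> Prop) (g : {mpoly F[n]}).

(** Linear independence over [F] of the classes of the [b i] in the quotient by [J]. *)
Definition free_modulo J (I : finType) (b : I -> {mpoly F[n]}) : Prop :=
  forall c : I -> F, J (\sum_i c i *: b i) -> forall i, c i = 0.

(** A relation modulo [J] is a polynomial in [g] with coefficients in the span of [b]. Modulo [J'],
    which contains [g], only the constant term survives, so it is zero by freeness. As [J] is prime
    and does not contain [g], a factor [g] then cancels, and induction applies. *)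
Lemma free_modulo_powers J J' g (I : finType) (b : I -> {mpoly F[n]}) N :
    prime_ideal J -> prime_ideal J' -> (forall p, J p -> J' p) ->
    J' g -> ~ J g -> free_modulo J' b ->
  free_modulo J (fun x : I * 'I_N => b x.1 * g ^+ x.2).
Proof.
move=> [J0 JB JM _ Jprime] [J'0 J'B J'M _ _] JJ' J'g nJg b_free c Jc.
suff coef0 M (h : nat -> I -> F) :
    J (\sum_(j < M) (\sum_i h j i *: b i) * g ^+ j) ->
    forall j i, (j < M)%N -> h j i = 0.
  (* Coefficients indexed by all naturals can be shifted in the induction; the default 0 fills the
     indices from [N] on. *)
  case=> i j; pose h k i := if insub k is Some j then c (i, j) else 0.
  have hE (k : 'I_N) l : h k l = c (l, k) by rewrite /h valK.
  rewrite -hE; apply: (coef0 N) (ltn_ord j).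
  suff -> : \sum_(j < N) (\sum_i h j i *: b i) * g ^+ j =
      \sum_x c x *: (b x.1 * g ^+ x.2) by [].
  transitivity (\sum_i \sum_(j < N) c (i, j) *: (b i * g ^+ j)); last first.
    by rewrite pair_bigA; apply: eq_bigr => -[].
  rewrite exchange_big /=.
  apply: eq_bigr => k _; rewrite mulr_suml; apply: eq_bigr => l _.
  by rewrite hE scalerAl.
elim: M h => [//|M IH] h; rewrite big_ord_recl expr0 mulr1.
have -> : \sum_(j < M) (\sum_i h (lift ord0 j) i *: b i) * g ^+ lift ord0 j =
    (\sum_(j < M) (\sum_i h j.+1 i *: b i) * g ^+ j) * g.
  by rewrite mulr_suml; apply: eq_bigr => j _; rewrite -mulrA -exprSr.
set S := \sum_(j < M) _ => JS.
have h0 i : h 0%N i = 0.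
  apply: b_free i; rewrite -[X in J' X](addrK (S * g)).
  by apply: J'B (JJ' _ JS) (J'M _ _ J'g).
have {}JS : J S.
  move: JS; rewrite big1 ?add0r => [|i _]; last by rewrite h0 scale0r.
  by case/Jprime.
by case=> [|j] i //; apply: (IH (fun k => h k.+1)).
Qed.

Lemma msizeM_le_pred p q : (msize (p * q : {mpoly F[n]}) <= (msize p + msize q).-1)%N.
Proof.
have [->|p0] := eqVneq p 0; first by rewrite mul0r msize0.
have [->|q0] := eqVneq q 0; first by rewrite mulr0 msize0.
by rewrite msizeM.
Qed.

(** Start from the family 1, free because [J 0] is proper, and at each inclusion multiply by the
    powers of [g i] below [N]. Since [msize] is the degree plus one, the [g i] have degree at most
    [d] and the products degree at most [K * (N * d)]. *)
Lemma free_modulo_chain (J : nat -> {mpoly F[n]} -> Prop) (g : nat -> {mpoly F[n]})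
    (K N d : nat) :
    (forall i, (i <= K)%N -> prime_ideal (J i)) ->
    (forall i, (i < K)%N -> forall p, J i.+1 p -> J i p) ->
    (forall i, (i < K)%N -> [/\ J i (g i), ~ J i.+1 (g i) & (msize (g i) <= d.+1)%N]) ->
  exists (I : finType) (b : I -> {mpoly F[n]}),
    [/\ #|I| = (N ^ K)%N, forall i, (msize (b i) <= (K * (N * d)).+1)%N &
        free_modulo (J K) b].
Proof.
elim: K => [|K IH] Jprime Jsub Jg.
  exists unit, (fun=> 1); split=> [|_|c]; rewrite ?card_unit ?msize1 //.
  rewrite (big_pred1 tt) => [Jc []|[]//].
  have [_ _ JM J1 _] := Jprime 0%N isT.
  have [//|c0] := eqVneq (c tt) 0; case: J1.
  by rewrite -[1](scalerK c0) -mul_mpolyC; apply: JM.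
have [i lei|i lti|i lti|I [b [cardI sizeb b_free]]] := IH.
- by apply: Jprime; rewrite leqW.
- by apply: Jsub; rewrite leqW.
- by apply: Jg; rewrite leqW.
exists (I * 'I_N)%type, (fun x : I * 'I_N => b x.1 * g K ^+ x.2); split.
- by rewrite card_prod cardI card_ord expnSr.
- case=> i j /=; have [_ _ sizeg] := Jg K (ltnSn K).
  have sizeX k : (msize (g K ^+ k) <= (k * d).+1)%N.
    elim: k => [|k IHk]; first by rewrite expr0 msize1.
    rewrite exprS; apply: leq_trans (msizeM_le_pred _ _) _.
    by move: IHk sizeg; rewrite mulSn; lia.
  apply: leq_trans (msizeM_le_pred _ _) _.
  have := sizeb i; have := sizeX j; have : (j * d <= N * d)%N.
    by rewrite leq_mul2r ltnW ?orbT.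
  rewrite mulSn; lia.
- have [JgK nJgK _] := Jg K (ltnSn K).
  by apply: free_modulo_powers (Jsub K _) JgK nJgK b_free => //; apply: Jprime.
Qed.

Lemma card_bmultinom_le D : (#|{: 'X_{1..n < D}}| <= D ^ n)%N.
Proof.
case: D => [|D]; first by rewrite eq_card0 // => x; have := bmdeg x.
rewrite -[X in (X ^ n)%N]card_ord -[X in (_ ^ X)%N]card_ord -card_ffun.
apply: (@leq_card _ _ (fun m : 'X_{1..n < D.+1} => [ffun i => inord (m i) : 'I_D.+1])).
move=> m m' /ffunP eqm; apply/val_inj/mnmP => i /=.
have le_mi (k : 'X_{1..n < D.+1}) : (k i < D.+1)%N.
  by apply: leq_ltn_trans (bmdeg k); rewrite mdegE (bigD1 i) //= leq_addr.
by have /(congr1 val) := eqm i; rewrite !ffunE /= !inordK.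
Qed.

(** If there were more polynomials than monomials of degree below [D], their coefficient matrix
    would have a nonzero left kernel: a linear relation in the polynomial ring itself, hence modulo
    [J]. *)
Lemma card_free_modulo J (I : finType) (b : I -> {mpoly F[n]}) D :
    J 0 -> (forall i, (msize (b i) <= D)%N) -> free_modulo J b ->
  (#|I| <= D ^ n)%N.
Proof.
move=> J0 sizeb b_free; apply: leq_trans (card_bmultinom_le D).
rewrite leqNgt; apply/negP => ltI.
pose M := \matrix_(i < #|I|, m < #|{: 'X_{1..n < D}}|)
  (b (enum_val i))@_(enum_val m).
have /rowV0Pn[c /sub_kermxP cM c_neq0] : kermx M != 0.
  by rewrite -mxrank_eq0 mxrank_ker subn_eq0 -ltnNge (leq_ltn_trans (rank_leq_col _)).
case/eqP: c_neq0; apply/rowP => k; rewrite mxE -[k]enum_valK.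
apply: (b_free (fun i => c 0 (enum_rank i))).
set S := \sum_i _; suff -> : S = 0 by [].
apply/mpolyP => m; rewrite mcoeff0.
have coefS : S@_m = \sum_i c 0 (enum_rank i) * (b i)@_m.
  by rewrite raddf_sum /=; apply: eq_bigr => i _; rewrite mcoeffZ.
have [ltm|lem] := ltnP (mdeg m) D; last first.
  rewrite coefS big1 // => i _; rewrite memN_msupp_eq0 ?mulr0 //.
  by rewrite msize_mdeg_ge // (leq_trans (sizeb i)).
have /rowP/(_ (enum_rank (BMultinom ltm))) := cM; rewrite !mxE => <-.
rewrite coefS (reindex (@enum_val I predT)) /=; last first.
  by exists enum_rank => i _; rewrite ?enum_valK ?enum_rankK.
by apply: eq_bigr => i _; rewrite mxE enum_valK enum_rankK.
Qed.

(* The products of powers below N of witnesses of strictness are free modulo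
   the last ideal: there are N ^ K of them, of degree O(N), whereas
   polynomials of degree O(N) span a space of dimension O(N ^ n). *)
Lemma prime_chain_length (J : nat -> {mpoly F[n]} -> Prop) (K : nat) :
    (forall i, (i <= K)%N -> prime_ideal (J i)) ->
    (forall i, (i < K)%N -> forall p, J i.+1 p -> J i p) ->
    (forall i, (i < K)%N -> exists2 p, J i p & ~ J i.+1 p) ->
  (K <= n)%N.
Proof.
move=> Jprime Jsub Jstrict; rewrite leqNgt; apply/negP => ltnK.
have /choice[g gP] (i : nat) : exists p, (i < K)%N -> J i p /\ ~ J i.+1 p.
  by case: (ltnP i K) => [/Jstrict[p]|]; [exists p | exists 0].
pose d := \max_(i < K) msize (g i).
(* With this [N], if [n < K] then [(N * (K * d).+1) ^ n < N ^ n.+1 <= N ^ K], which contradicts the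
   count of monomials. *)
pose N := ((K * d).+1 ^ n).+1.
have [||i ltiK|I [b [cardI sizeb b_free]]] := @free_modulo_chain J g K N d.
- exact: Jprime.
- exact: Jsub.
- have [Jg nJg] := gP i ltiK; split=> //.
  by rewrite leqW // (leq_bigmax (Ordinal ltiK)).
have [J0 _ _ _ _] := Jprime K (leqnn K).
have := card_free_modulo J0 sizeb b_free; rewrite cardI leqNgt => /negP; apply.
apply: (@leq_ltn_trans ((N * (K * d).+1) ^ n)).
  have [->//|n_gt0] := posnP n.
  by rewrite leq_exp2r // mulnS mulnCA -addn1 addnC leq_add2r.
rewrite expnMn. apply: (@leq_trans (N ^ n * N)).
  by rewrite ltn_pmul2l ?expn_gt0.
by rewrite -expnSr leq_pexp2l.
Qed.

End KrullDimension.

(** * Dimension of a hypersurface *)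

Section HypersurfaceDimension.
Variables (R : realType) (n : nat).
Implicit Types (X V : set 'rV[R]_n) (p : {mpoly R[n]}).

Definition vanishing X p : Prop :=
  forall x, X x -> p.@[fun k => x ord0 k] = 0.

Lemma subvariety_vanishing X p :
  subvariety X -> subvariety (X `&` [set x | p.@[fun k => x ord0 k] = 0]).
Proof.
case=> P ->; exists (P `|` [set p]); apply/seteqP; split=> x.
  by case=> Px px q [/Px|->].
by move=> Px; split=> [q Pq|]; apply: Px; [left | right].
Qed.

(** If [p * q] vanishes on [X], then [X] is the union of its intersections with the zero sets of [p]
    and [q], and irreducibility selects one of them. *)
Lemma irreducible_vanishing X : irreducible_subvariety X -> prime_ideal (vanishing X).
Proof.
case=> Xvar [x0 Xx0] Xirr; split.
- by move=> x _; rewrite meval0.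
- by move=> p q Xp Xq x Xx; rewrite mevalB Xp ?Xq ?subr0.
- by move=> p q Xq x Xx; rewrite mevalM Xq ?mulr0.
- by move=> X1; have /eqP := X1 _ Xx0; rewrite meval1 oner_eq0.
move=> p q Xpq.
have [|XE|XE] := Xirr _ _ (subvariety_vanishing p Xvar) (subvariety_vanishing q Xvar).
- apply/seteqP; split=> [x Xx|x [[]|[]] //].
  by have /eqP := Xpq _ Xx; rewrite mevalM mulf_eq0 => /orP[]/eqP; [left|right].
- by left=> x; rewrite XE; case.
- by right=> x; rewrite XE; case.
Qed.

(** A chain of length [k] inside the hypersurface gives a descending chain of vanishing ideals, all
    containing [p]. Appending the zero ideal makes it one step longer, so [k.+1 <= n]. *)
Lemma dimension_hypersurface p :
  p != 0 -> (dimension (zero_locus [set p]) < n%:R%:E)%E.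
Proof.
(* The bound [n - 1] is taken in [R], so that for [n = 0] it still covers the empty locus, of
   dimension -oo. *)
move=> p0; apply: (@le_lt_trans _ _ (n%:R - 1)%:E); last first.
  by rewrite lte_fin ltrBlDr ltrDl.
apply: ub_ereal_sup => _ [k [X [Xirr Xlt]] <-].
rewrite lee_fin lerBrDr natr1 ler_nat.
pose J i := if (i <= k)%N then vanishing (X i) else eq^~ (0 : {mpoly R[n]}).
apply: (@prime_chain_length _ n J).
- move=> i lei; rewrite /J; case: leqP => [{}lei|_].
    by apply: irreducible_vanishing; case: (Xirr i lei).
  split=> // [_ _ -> ->|q _ ->||q r /eqP]; rewrite ?subr0 ?mulr0 //.
    by apply/eqP; rewrite oner_eq0.
  by rewrite mulf_eq0 => /orP[]/eqP; [left|right].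
- move=> i; rewrite ltnS => lei q; rewrite /J lei; case: leqP => [_ ->|lti].
    by move=> x _; rewrite meval0.
  by move=> Xq x Xx; apply: Xq; have [Xsub _] := Xlt i lti; apply: Xsub.
- move=> i; rewrite ltnS => lei; rewrite /J lei; case: leqP => [_|lti].
    exists p; last exact/eqP.
    by move=> x Xx; have [_ /(_ _ Xx)] := Xirr i lei; apply.
  (* Some equation of [X i] fails at a point of [X i.+1] outside [X i]. *)
  have [_ nXsub] := Xlt i lti.
  have [[P XE] _ _] := (Xirr i lei).1.
  have [x XSx nXx] : exists2 x, X i.+1 x & ~ X i x.
    apply: contrapT => nex; apply: nXsub => x Xx; apply: contrapT => nXx.
    by apply: nex; exists x.
  have [q Pq qx] : exists2 q, P q & q.@[fun k => x ord0 k] <> 0.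
    apply: contrapT => nex; apply: nXx; rewrite XE => q Pq; apply: contrapT => qx.
    by apply: nex; exists q.
  by exists q => [y|/(_ _ XSx)//]; rewrite XE => /(_ _ Pq).
Qed.

End HypersurfaceDimension.

(** * Elimination of square roots *)

Section Elimination.
Variable R : realType.

(** The algebra of functions generated by [C]. As an inductive predicate it allows proofs by
    induction without choosing polynomial representatives. *)
Inductive polyfun (X : Type) (C : (X -> R) -> Prop) : (X -> R) -> Prop :=
| polyfun_gen f : C f -> polyfun C f
| polyfun_cst c : polyfun C (fun=> c)
| polyfun_add f g : polyfun C f -> polyfun C g -> polyfun C (fun x => f x + g x)
| polyfun_mul f g : polyfun C f -> polyfun C g -> polyfun C (fun x => f x * g x).

Section Closure.
Variables (X : Type) (C : (X -> R) -> Prop).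

Lemma polyfun_opp f : polyfun C f -> polyfun C (fun x => - f x).
Proof.
move=> Cf; have -> : (fun x => - f x) = (fun x => -1 * f x).
  by apply/funext => x; rewrite mulN1r.
by apply: polyfun_mul => //; apply: polyfun_cst.
Qed.

Lemma polyfun_sub f g :
  polyfun C f -> polyfun C g -> polyfun C (fun x => f x - g x).
Proof. by move=> Cf Cg; apply: polyfun_add => //; apply: polyfun_opp. Qed.

Lemma polyfun_exp f k : polyfun C f -> polyfun C (fun x => f x ^+ k).
Proof.
move=> Cf; elim: k => [|k IH].
  by under eq_fun => x do rewrite expr0; apply: polyfun_cst.
by under eq_fun => x do rewrite exprS; apply: polyfun_mul.
Qed.

Lemma polyfun_sum (I : finType) (f : I -> X -> R) :
  (forall i, polyfun C (f i)) -> polyfun C (fun x => \sum_i f i x).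
Proof.
move=> Cf; elim: (index_enum I) => [|i s IH].
  by under eq_fun => x do rewrite big_nil; apply: polyfun_cst.
by under eq_fun => x do rewrite big_cons; apply: polyfun_add.
Qed.

Lemma polyfun_prod (I : finType) (f : I -> X -> R) :
  (forall i, polyfun C (f i)) -> polyfun C (fun x => \prod_i f i x).
Proof.
move=> Cf; elim: (index_enum I) => [|i s IH].
  by under eq_fun => x do rewrite big_nil; apply: polyfun_cst.
by under eq_fun => x do rewrite big_cons; apply: polyfun_mul.
Qed.

Lemma polyfun_det k (A : X -> 'M[R]_k) :
  (forall i j, polyfun C (fun x => A x i j)) -> polyfun C (fun x => \det (A x)).
Proof.
move=> CA; apply: polyfun_sum => s; apply: polyfun_mul; first exact: polyfun_cst.
exact: polyfun_prod.
Qed.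

Lemma polyfun_trans (C' : (X -> R) -> Prop) f :
  (forall g, C g -> polyfun C' g) -> polyfun C f -> polyfun C' f.
Proof.
move=> CC'; elim=> [g /CC'//|c|g h _ Cg _ Ch|g h _ Cg _ Ch].
- exact: polyfun_cst.
- exact: polyfun_add.
- exact: polyfun_mul.
Qed.

(* The norm from C[r] down to C, where the conjugation phi only changes the
   sign of r. *)
Lemma polyfun_norm (r : X -> R) (phi : X -> X) f :
    (forall c, C c -> c \o phi = c) -> (forall x, r (phi x) = - r x) ->
    polyfun C (fun x => r x ^+ 2) ->
    polyfun (fun g => C g \/ g = r) f ->
  polyfun C (fun x => f x * f (phi x)).
Proof.
move=> phiC phir Cr2 Cf.
(* As [r ^+ 2] is polynomial in [C], every element of C[r] has the form [p + q * r]. The map [phi]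
   fixes [p] and [q], so the norm is [p ^+ 2 - q ^+ 2 * r ^+ 2]. *)
have [p [q [Cp Cq fE]]] : exists p q,
    [/\ polyfun C p, polyfun C q & f = fun x => p x + q x * r x].
  elim: Cf => [g [Cg|->]|c|g h _ [p [q [Cp Cq ->]]] _ [p' [q' [Cp' Cq' ->]]]
                         |g h _ [p [q [Cp Cq ->]]] _ [p' [q' [Cp' Cq' ->]]]].
  - exists g, (fun=> 0); split; [exact: polyfun_gen | exact: polyfun_cst |].
    by apply/funext => x; rewrite mul0r addr0.
  - exists (fun=> 0), (fun=> 1); split; [exact: polyfun_cst | exact: polyfun_cst |].
    by apply/funext => x; rewrite mul1r add0r.
  - exists (fun=> c), (fun=> 0); split; [exact: polyfun_cst | exact: polyfun_cst |].
    by apply/funext => x; rewrite mul0r addr0.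
  - exists (fun x => p x + p' x), (fun x => q x + q' x).
    by split; [exact: polyfun_add | exact: polyfun_add | apply/funext => x; ring].
  - exists (fun x => p x * p' x + q x * q' x * r x ^+ 2),
      (fun x => p x * q' x + q x * p' x).
    split; last by apply/funext => x; ring.
      apply: polyfun_add; first exact: polyfun_mul.
      by apply: polyfun_mul Cr2; apply: polyfun_mul.
    by apply: polyfun_add; apply: polyfun_mul.
have phi_inv g : polyfun C g -> forall x, g (phi x) = g x.
  elim=> [c /phiC cE x|//|g1 g2 _ E1 _ E2 x|g1 g2 _ E1 _ E2 x].
  - by rewrite -[in RHS]cE.
  - by rewrite E1 E2.
  - by rewrite E1 E2.
have -> : (fun x => f x * f (phi x)) = (fun x => p x ^+ 2 - q x ^+ 2 * r x ^+ 2).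
  by apply/funext => x; rewrite fE phir !phi_inv //; ring.
apply: polyfun_sub; first exact: polyfun_exp.
by apply: polyfun_mul => //; apply: polyfun_exp.
Qed.

End Closure.

Variables (Y : Type) (n : nat) (coord : 'I_n -> Y -> R).
Variables (m : nat) (q : 'I_m -> Y -> R).

(** The signs are part of the argument, so that a conjugation is a map of the domain that flips one
    bit. *)
Definition signed_root (i : 'I_m) (x : Y * ('I_m -> bool)) : R :=
  (-1) ^+ x.2 i * q i x.1.

Definition coordinate (f : Y * ('I_m -> bool) -> R) : Prop :=
  exists k, f = fun x => coord k x.1.

(** The bound [k] leaves only the first [k] roots, so that they can be eliminated one at a time. *)
Definition coordinate_or_root (k : nat) (f : Y * ('I_m -> bool) -> R) : Prop :=
  coordinate f \/ exists2 i : 'I_m, (i < k)%N & f = signed_root i.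

Lemma polyfun_mpoly (f : Y * ('I_m -> bool) -> R) : polyfun coordinate f ->
  exists p : {mpoly R[n]}, forall x, f x = p.@[fun k => coord k x.1].
Proof.
elim=> [_ [k ->]|c|g h _ [p gp] _ [p' hp']|g h _ [p gp] _ [p' hp']].
- by exists 'X_k => x; rewrite mevalXU.
- by exists c%:MP => x; rewrite mevalC.
- by exists (p + p') => x; rewrite mevalD gp hp'.
- by exists (p * p') => x; rewrite mevalM gp hp'.
Qed.

(** The last root is removed by multiplying [f] with its conjugate. The product vanishes for some
    choice of signs exactly when [f] does, since the flipped choice is again a choice of signs. *)
Lemma sign_elimination (f : Y * ('I_m -> bool) -> R) :
    (forall i, polyfun coordinate (fun x => q i x.1 ^+ 2)) ->
    polyfun (coordinate_or_root m) f ->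
  exists p : {mpoly R[n]}, forall y,
    p.@[fun k => coord k y] = 0 <-> exists e, f (y, e) = 0.
Proof.
move=> q2; suff elim k : (k <= m)%N -> forall g,
    polyfun (coordinate_or_root k) g ->
    exists p : {mpoly R[n]}, forall y,
      p.@[fun k => coord k y] = 0 <-> exists e, g (y, e) = 0.
  exact: elim.
elim: k => [_|k IH ltkm] g Cg.
  have [|p gp] := @polyfun_mpoly g.
    by apply: polyfun_trans Cg => h [Ch|[]//]; apply: polyfun_gen.
  exists p => y; split=> [py|[e]]; last by rewrite gp.
  by exists (fun=> false); rewrite gp.
pose i := Ordinal ltkm.
pose flip (x : Y * ('I_m -> bool)) := (x.1, fun j => (j == i) (+) x.2 j).
have [|p pE] := IH (ltnW ltkm) (fun x => g x * g (flip x)).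
  apply: (@polyfun_norm _ _ (signed_root i)).
  - move=> c [[j ->//]|[j ltjk ->]]; apply/funext => x.
    by rewrite /signed_root /= -val_eqE /= ltn_eqF.
  - by move=> x; rewrite /signed_root /= eqxx signr_addb mulN1r mulNr.
  - have -> : (fun x => signed_root i x ^+ 2) = (fun x => q i x.1 ^+ 2).
      by apply/funext => x; rewrite exprMn sqrr_sign mul1r.
    by apply: polyfun_trans (q2 i) => h Ch; apply: polyfun_gen; left.
  - apply: polyfun_trans Cg => h [Ch|[j ltjk ->]]; apply: polyfun_gen.
      by left; left.
    move: ltjk; rewrite ltnS leq_eqVlt => /predU1P[jk|ltjk].
      by right; congr signed_root; apply: val_inj.
    by left; right; exists j.
exists p => y; rewrite pE; split=> -[e].
  move/eqP; rewrite mulf_eq0 => /orP[]/eqP ge; first by exists e.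
  by exists (flip (y, e)).2.
by move=> ge; exists e; rewrite ge mul0r.
Qed.

End Elimination.

(** * Nonsingular positions *)

Section Geometry.
Variable R : realType.
Implicit Types (u v w b c d s : 'rV[R]_3) (a : 'M[R]_(5, 3)) (r t : 'cV[R]_5).

Lemma dotE u v : dot u v = \sum_k u 0 k * v 0 k.
Proof. by rewrite /dot mxE; apply: eq_bigr => k _; rewrite mxE. Qed.

Lemma dotC u v : dot u v = dot v u.
Proof. by rewrite !dotE; apply: eq_bigr => k _; rewrite mulrC. Qed.

Lemma dotDl u v w : dot (u + v) w = dot u w + dot v w.
Proof. by rewrite /dot mulmxDl mxE. Qed.

Lemma dotZl x u v : dot (x *: u) v = x * dot u v.
Proof. by rewrite /dot -scalemxAl mxE. Qed.

Lemma dotNl u v : dot (- u) v = - dot u v.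
Proof. by rewrite -scaleN1r dotZl mulN1r. Qed.

Lemma dotDr u v w : dot w (u + v) = dot w u + dot w v.
Proof. by rewrite !(dotC w) dotDl. Qed.

Lemma dotZr x u v : dot u (x *: v) = x * dot u v.
Proof. by rewrite !(dotC u) dotZl. Qed.

Lemma dotNr u v : dot u (- v) = - dot u v.
Proof. by rewrite !(dotC u) dotNl. Qed.

Definition dot_linear := (dotDl, dotDr, dotNl, dotNr, dotZl, dotZr).

Lemma dot0r u : dot u 0 = 0.
Proof. by rewrite -(scale0r 0) dotZr mul0r. Qed.

Lemma dot0l u : dot 0 u = 0.
Proof. by rewrite dotC dot0r. Qed.

Lemma dotBB u v : dot (u - v) (u - v) = dot u u - dot u v *+ 2 + dot v v.
Proof. by rewrite !dot_linear (dotC v u); ring. Qed.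

Lemma dot_ge0 u : 0 <= dot u u.
Proof. by rewrite dotE sumr_ge0 // => k _; rewrite -expr2 sqr_ge0. Qed.

Lemma dot_eq0 u : (dot u u == 0) = (u == 0).
Proof.
apply/eqP/eqP => [|->]; last exact: dot0r.
rewrite dotE => /eqP; rewrite psumr_eq0 => [/allP u0|k _]; last by rewrite -expr2 sqr_ge0.
apply/rowP => k; have := u0 k (mem_index_enum k).
by rewrite mulf_eq0 orbb mxE => /eqP.
Qed.

Lemma enorm_sqr u : enorm u ^+ 2 = dot u u.
Proof. by rewrite sqr_sqrtr ?dot_ge0. Qed.

Definition gram c b : R := dot c c * dot b b - dot c b ^+ 2.

(** Equality case of Cauchy-Schwarz: the difference of the two sides has squared norm
    [dot c c * gram c b]. *)
Lemma gram_eq0 c b : gram c b = 0 -> dot c c *: b = dot c b *: c.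
Proof.
move=> cb0; apply/eqP; rewrite -subr_eq0 -dot_eq0 !dot_linear (dotC b c).
by apply/eqP; transitivity (dot c c * gram c b); [rewrite /gram; ring | rewrite cb0 mulr0].
Qed.

Lemma exists_orthogonal u : exists2 w, w != 0 & dot w u = 0.
Proof.
have /rowV0Pn[w /sub_kermxP wu w0] : kermx u^T != 0.
  by rewrite -mxrank_eq0 mxrank_ker subn_eq0 -ltnNge (leq_ltn_trans (rank_leq_col _)).
by exists w => //; rewrite /dot wu mxE.
Qed.

(* The bisector plane of 0 and d contains a line off the origin, which meets
   each of the lines spanned by c1 and c2 at most once. *)
Lemma bisector_avoid d c1 c2 : c1 != 0 -> c2 != 0 ->
  exists b, [/\ dot b d *+ 2 = dot d d, gram c1 b != 0 & gram c2 b != 0].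
Proof.
move=> c1_neq0 c2_neq0.
have [g g_neq0 [w [w_neq0 wg wd gd]]] : exists2 g, g != 0 &
    exists w, [/\ w != 0, dot w g = 0, dot w d = 0 & dot g d *+ 2 = dot d d].
  (* For [d = 0] the bisector condition is vacuous and any nonzero [g] serves; otherwise [g] is the
     midpoint of 0 and [d]. *)
  have [->|d_neq0] := eqVneq d 0.
    have one_neq0 : const_mx 1 != 0 :> 'rV[R]_3.
      by apply/eqP => /rowP/(_ 0)/eqP; rewrite !mxE oner_eq0.
    have [w w0 w1] := exists_orthogonal (const_mx 1).
    by exists (const_mx 1) => //; exists w; rewrite !dot0r mul0rn.
  have [w w0 w1] := exists_orthogonal d.
  exists (2^-1 *: d); first by rewrite scaler_eq0 negb_or invr_eq0 pnatr_eq0.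
  by exists w; rewrite dotZr w1 mulr0 dotZl; split=> //; field.
(* Two points of the line parallel to [c] would make [w], and then [g], parallel to [c]. But [g] is
   orthogonal to [w], so it would be zero. *)
have bad_unique c x y : c != 0 -> gram c (g + x *: w) = 0 ->
    gram c (g + y *: w) = 0 -> x = y.
  rewrite -dot_eq0 => c0 /gram_eq0 cx /gram_eq0 cy.
  apply/eqP; rewrite -subr_eq0; apply: contraT => xy.
  have wc : ((x - y) * dot c c) *: w =
      (dot c (g + x *: w) - dot c (g + y *: w)) *: c.
    by rewrite scalerBl -cx -cy -scalerBr opprD addrACA subrr add0r -scalerBl scalerA mulrC.
  have [k wE] : exists k, w = k *: c.
    exists (((x - y) * dot c c)^-1 * (dot c (g + x *: w) - dot c (g + y *: w))).
    by rewrite -scalerA -wc scalerA mulVf ?scale1r // mulf_neq0.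
  have k0 : k != 0 by apply: contraNneq w_neq0 => k0; rewrite wE k0 scale0r.
  have cg : dot c g = 0.
    by move: wg; rewrite wE dotZl => /eqP; rewrite mulf_eq0 (negPf k0) => /eqP.
  have gE : dot c c *: g = (dot c (g + x *: w) - x * k * dot c c) *: c.
    rewrite scalerBl -cx scalerDr [in x *: w]wE !scalerA.
    rewrite [X in _ + X - _](_ : _ = (x * k * dot c c) *: c) ?addrK //.
    by congr (_ *: _); ring.
  have : dot (dot c c *: g) g = 0 by rewrite gE dotZl cg mulr0.
  by move/eqP; rewrite dotZl mulf_eq0 (negPf c0) dot_eq0 (negPf g_neq0).
have on_bisector x : dot (g + x *: w) d *+ 2 = dot d d.
  by rewrite dotDl dotZl wd mulr0 addr0.
apply: contrapT => nb.
have bad x : gram c1 (g + x *: w) = 0 \/ gram c2 (g + x *: w) = 0.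
  have [|g1] := eqVneq (gram c1 (g + x *: w)) 0; first by left.
  have [|g2] := eqVneq (gram c2 (g + x *: w)) 0; first by right.
  by case: nb; exists (g + x *: w).
have u1 := bad_unique _ _ _ c1_neq0; have u2 := bad_unique _ _ _ c2_neq0.
(* Three points of the line and two directions to avoid: by pigeonhole two of the points would lie
   in the same direction. *)
have [] := bad 0; have [] := bad 1; have [] := bad 2%:R => B2 B1 B0.
all: by first [have := u1 _ _ B0 B1; lra | have := u1 _ _ B0 B2; lra
  | have := u1 _ _ B1 B2; lra | have := u2 _ _ B0 B1; lra
  | have := u2 _ _ B0 B2; lra | have := u2 _ _ B1 B2; lra].
Qed.

(** This renumbers the microphones so that two with different sources come first. *)
Lemma exists_perm01 n (i j : 'I_n.+2) : i != j ->
  exists p : 'S_n.+2, p 0 = i /\ p 1 = j.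
Proof.
move=> ij; exists (tperm 1%R (tperm 0%R i j) * tperm 0%R i)%g.
split; rewrite permM; last by rewrite tpermL tpermK.
rewrite (@tpermD _ 1%R (tperm 0%R i j) 0%R) ?tpermL //.
by rewrite -(inj_eq (@perm_inj _ (tperm 0 i))) tpermK tpermL eq_sym.
Qed.

Lemma ord5_ind (P : 'I_5 -> Prop) :
  P 0 -> P 1 -> P 2%:R -> P 3%:R -> P 4%:R -> forall k, P k.
Proof.
have k_val m (lt5 : (m < 5)%N) : Ordinal lt5 = m%:R.
  by apply: val_inj; rewrite /= Zp_nat /= modn_small.
by move=> P0 P1 P2 P3 P4 [[|[|[|[|[|//]]]]]] ltk; rewrite k_val.
Qed.

Lemma sum_ord5 (f : 'I_5 -> R) :
  \sum_k f k = f 0 + f 1 + f 2%:R + f 3%:R + f 4%:R.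
Proof.
rewrite !big_ord_recl big_ord0 /= !addrA addr0.
by do !congr (_ + _); congr f; apply: val_inj.
Qed.

(* A symmetric 3 x 3 matrix with zero diagonal has determinant 2 x y z. *)
Lemma zero_diag3_ker (x y z u v w : R) : x != 0 -> y != 0 -> z != 0 ->
    v * x + w * y = 0 -> u * x + w * z = 0 -> u * y + v * z = 0 ->
  [/\ u = 0, v = 0 & w = 0].
Proof.
move=> x0 y0 z0 e1 e2 e3.
have two0 : 2 != 0 :> R by rewrite pnatr_eq0.
have uE : 2 * x * y * u = 0.
  transitivity (y * (u * x + w * z) + x * (u * y + v * z) - z * (v * x + w * y)); first ring.
  by rewrite e1 e2 e3; ring.
have u0 : u = 0 by move/eqP: uE; rewrite !mulf_eq0 (negPf two0) (negPf x0) (negPf y0) => /eqP.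
move/eqP: e2; rewrite u0 mul0r add0r mulf_eq0 (negPf z0) orbF => /eqP ->.
by move/eqP: e3; rewrite u0 mul0r add0r mulf_eq0 (negPf z0) orbF => /eqP ->.
Qed.

Lemma matDE a t i j : matD a t i j =
  (t i 0 - t j 0) ^+ 2 - dot (row i a - row j a) (row i a - row j a).
Proof. by rewrite mxE enorm_sqr. Qed.

(* Microphones i and j sit at s i, where t i = 0; the others lie in the bisector
   planes of s i and s k, in pairwise nonparallel directions from s i. Whatever
   the signs of the t k, row i of matD then has a single nonzero entry, and by
   the strict Cauchy-Schwarz inequality the off-diagonal entries of the
   remaining 3 x 3 block are nonzero. *)
Lemma exists_matD_nonsingular (s : 'I_5 -> 'rV[R]_3) i j : s i != s j ->
  exists a, forall t, (forall k, t k 0 ^+ 2 = dot (s k - row k a) (s k - row k a)) ->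
    \det (matD a t) != 0.
Proof.
move=> sij; have /exists_perm01[p [p0 p1]] : i != j by apply: contraNneq sij => ->.
pose d k := s (p k) - s i.
have e_neq0 : const_mx 1 != 0 :> 'rV[R]_3.
  by apply/eqP => /rowP/(_ 0)/eqP; rewrite !mxE oner_eq0.
have gram_neq0 c b : gram c b != 0 -> b != 0.
  apply: contraNneq => ->; by rewrite /gram !dot0r mulr0 expr0n subrr.
(* The direction [const_mx 1] is arbitrary; avoiding it ensures that [b2] is nonzero. *)
have [b2 [bis2 /gram_neq0 b2_neq0 _]] := bisector_avoid (d 2%:R) e_neq0 e_neq0.
have [b3 [bis3 /[dup] g23 /gram_neq0 b3_neq0 _]] := bisector_avoid (d 3%:R) b2_neq0 b2_neq0.
have [b4 [bis4 g24 g34]] := bisector_avoid (d 4%:R) b2_neq0 b3_neq0.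
pose b (k : 'I_5) := nth 0 [:: 0; 0; b2; b3; b4] k.
pose a := \matrix_k (s i + b (p^-1%g k)).
have rowE k : row (p k) a = s i + b k by rewrite rowK permK.
exists a => t tE.
have {}tE k : t (p k) 0 ^+ 2 = dot (d k - b k) (d k - b k).
  by rewrite tE rowE /d opprD addrA.
have d0 : d 0 = 0 by rewrite /d p0 subrr.
have DE k l : matD a t (p k) (p l) = (t (p k) 0 - t (p l) 0) ^+ 2 - dot (b k - b l) (b k - b l).
  by rewrite matDE !rowE opprD addrACA subrr add0r.
have Dsym k l : matD a t k l = matD a t l k.
  by rewrite !matDE -sqrrN opprB -[row l a - _]opprB dotNl dotNr opprK.
have d1 : d 1 != 0 by rewrite /d p1 subr_eq0 eq_sym.
have b0 : b 0 = 0 by [].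
have b1 : b 1 = 0 by [].
have bis (k : 'I_5) : k != 1 -> dot (b k) (d k) *+ 2 = dot (d k) (d k).
  by elim/ord5_ind: k => // _; rewrite d0 !dot0r mul0rn.
have {}g23 : gram (b 2%:R) (b 3%:R) != 0 by [].
have {}g24 : gram (b 2%:R) (b 4%:R) != 0 by [].
have {}g34 : gram (b 3%:R) (b 4%:R) != 0 by [].
clearbody b d; move: (matD a t) DE Dsym => D DE Dsym.
clear a rowE e_neq0 gram_neq0 b2 b3 b4 b2_neq0 b3_neq0 bis2 bis3 bis4.
have sqr0 : t (p 0) 0 = 0.
  by apply/eqP; rewrite -sqrf_eq0 tE d0 b0 subrr dot0r.
(* A point on the bisector is as far from [d k] as from 0, so [t] is the norm of [b k] up to
   sign. *)
have tb k : k != 1 -> t (p k) 0 ^+ 2 = dot (b k) (b k).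
  by move=> /bis bd; rewrite tE dotBB -bd (dotC (d k)) subrr add0r.
have D0 k : k != 1 -> D (p k) (p 0) = 0.
  by move=> k1; rewrite DE sqr0 !subr0 tb // b0 subr0 subrr.
have D01 : D (p 0) (p 1) != 0.
  by rewrite DE sqr0 sub0r sqrrN tE b0 b1 !subr0 dot0r subr0 dot_eq0.
have Dgram k l : k != 1 -> l != 1 -> gram (b k) (b l) != 0 -> D (p k) (p l) != 0.
  move=> k1 l1; apply: contraNneq; rewrite DE dotBB => D_eq0.
  have tkl : t (p k) 0 * t (p l) 0 = dot (b k) (b l).
    by have := tb k k1; have := tb l l1; lra.
  by rewrite /gram -!tb // -exprMn tkl subrr.
apply/negP => /det0P[v v_neq0 /rowP vD]; case/eqP: v_neq0; apply/rowP => k; rewrite mxE.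
have {}vD l : v 0 (p 0) * D (p 0) (p l) + v 0 (p 1) * D (p 1) (p l) +
    v 0 (p 2%:R) * D (p 2%:R) (p l) + v 0 (p 3%:R) * D (p 3%:R) (p l) +
    v 0 (p 4%:R) * D (p 4%:R) (p l) = 0.
  by have := vD (p l); rewrite !mxE (reindex_perm p) sum_ord5.
have D0' l : l != 1 -> D (p 0) (p l) = 0 by rewrite Dsym; apply: D0.
have Dkk l : D (p l) (p l) = 0 by rewrite DE !subrr dot0r expr0n subrr.
(* Column [p 0] forces the entry of [v] at [p 1] to be zero, the 3 x 3 block then treats the last
   three entries, and column [p 1] the remaining one. *)
have v1 : v 0 (p 1) = 0.
  have /eqP := vD 0; rewrite (D0 0) // (D0 2%:R) // (D0 3%:R) // (D0 4%:R) // [D (p 1) _]Dsym !mulr0 add0r !addr0.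
  by rewrite mulf_eq0 (negPf D01) orbF => /eqP.
have [v2 v3 v4] : [/\ v 0 (p 2%:R) = 0, v 0 (p 3%:R) = 0 & v 0 (p 4%:R) = 0].
  apply: (@zero_diag3_ker (D (p 2%:R) (p 3%:R)) (D (p 2%:R) (p 4%:R)) (D (p 3%:R) (p 4%:R))).
  - exact: Dgram.
  - exact: Dgram.
  - exact: Dgram.
  - by rewrite -[RHS](vD 2%:R) D0' // v1 Dkk [D (p 3%:R) _]Dsym [D (p 4%:R) _]Dsym; ring.
  - by rewrite -[RHS](vD 3%:R) D0' // v1 Dkk [D (p 4%:R) _]Dsym; ring.
  - by rewrite -[RHS](vD 4%:R) D0' // v1 Dkk; ring.
have v0 : v 0 (p 0) = 0.
  have /eqP := vD 1; rewrite v1 v2 v3 v4 !mul0r !addr0.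
  by rewrite mulf_eq0 (negPf D01) orbF => /eqP.
by rewrite -(permKV p k); elim/ord5_ind: (p^-1%g k).
Qed.

(** * The linear system of [matA] *)

Lemma matA_mulE a t (x : R) u (c : R) i :
  ((matA a t : 'M_(5, 1 + (3 + 1))) *m col_mx x%:M (col_mx u^T c%:M)) i 0 =
    - 2 * t i 0 * x + 2 * dot (row i a) u - c.
Proof.
rewrite /matA /mattA mul_row_col mul_row_col !mxE !big_ord1 !mxE eqxx !mulr1n.
rewrite dotE mulr_sumr mulN1r addrA; congr (_ + _ - _).
by apply: eq_bigr => k _; rewrite !mxE mulrA.
Qed.

Lemma det_matA_neq0P a t : \det (matA a t) != 0 <->
  forall x u (c : R), (forall i, - 2 * t i 0 * x + 2 * dot (row i a) u - c = 0) ->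
    [/\ x = 0, u = 0 & c = 0].
Proof.
split=> [det_neq0 x u c eq0|inj].
  have Aunit : matA a t \in unitmx by rewrite unitmxE unitfE.
  have z0 : col_mx x%:M (col_mx u^T c%:M) = 0 :> 'cV_(1 + (3 + 1)).
    rewrite -[LHS](mulKmx Aunit); apply/colP => i; rewrite [RHS]mxE.
    suff -> : matA a t *m col_mx x%:M (col_mx u^T c%:M) = 0 by rewrite mulmx0 mxE.
    by apply/colP => k; rewrite matA_mulE eq0 mxE.
  have := z0; rewrite -(col_mx0 _ _ _ _) => /eq_col_mx[/matrixP/(_ 0 0) + /eqP].
  rewrite col_mx_eq0 => + /andP[/eqP/(congr1 trmx) + /eqP/matrixP/(_ 0 0)].
  by rewrite trmxK trmx0 !mxE.
rewrite -det_tr; apply/negP => /det0P[v v_neq0 /(congr1 trmx)].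
rewrite trmx_mul trmxK trmx0 => Av0; case/eqP: v_neq0; apply: trmx_inj.
pose z : 'cV_(1 + (3 + 1)) := v^T.
have zE : z = col_mx (usubmx z 0 0)%:M
    (col_mx (usubmx (dsubmx z))^T^T (dsubmx (dsubmx z) 0 0)%:M).
  by rewrite -!mx11_scalar trmxK !vsubmxK.
have [i|x0 u0 c0] := inj (usubmx z 0 0) (usubmx (dsubmx z))^T (dsubmx (dsubmx z) 0 0).
  by rewrite -matA_mulE -zE Av0 mxE.
by rewrite -/z zE x0 u0 c0 trmx0 !raddf0 !col_mx0.
Qed.

(** Shifting all times by [t0] adds a multiple of the constant last column of [matA] to its first
    one. On kernel vectors this replaces [c] by [c + 2 * t0 * x]. *)
Lemma det_matA_shift a r t (t0 : R) : (forall i, t i 0 = t0 + r i 0) ->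
  \det (matA a r) != 0 -> \det (matA a t) != 0.
Proof.
move=> tE /det_matA_neq0P inj; apply/det_matA_neq0P => x u c eq0.
have [|x0 u0 c0] := inj x u (c + 2 * t0 * x).
  by move=> i; rewrite -[RHS](eq0 i) tE; ring.
by split=> //; move: c0; rewrite x0; lra.
Qed.

(** Expanding the squared distance equations makes them linear in [t0], [s] and the extra unknown
    [dot s s - t0 ^+ 2]. *)
Lemma linear_solutionE a t (t0 : R) s :
    (forall i, (t i 0 - t0) ^+ 2 = dot (s - row i a) (s - row i a)) ->
    \det (matA a t) != 0 ->
  linear_solution a t = (t0, s).
Proof.
move=> tE det_neq0; have Aunit : matA a t \in unitmx by rewrite unitmxE unitfE.
have wE : vecw a t =
    (matA a t : 'M_(5, 1 + (3 + 1))) *m col_mx t0%:M (col_mx s^T (dot s s - t0 ^+ 2)%:M).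
  apply/colP => i; rewrite matA_mulE mxE enorm_sqr.
  have := tE i; rewrite dotBB (dotC s) => tiE.
  by rewrite sqrrB in tiE; lra.
rewrite /linear_solution wE [invmx _ *m _](mulKmx Aunit).
by rewrite col_mxKu col_mxKd col_mxKu trmxK mxE.
Qed.

(* Microphone 0 sits at s and the others at s + e k and s + (1, 1, 1): the r k have squares 0, 1, 1, 1
   and 3, and no signed sum of three units has square 3. *)
Lemma exists_matA_nonsingular s :
  exists a, forall r, (forall k, r k 0 ^+ 2 = dot (s - row k a) (s - row k a)) ->
    \det (matA a r) != 0.
Proof.
pose e (k : 'I_3) : 'rV[R]_3 := delta_mx 0 k.
pose b (k : 'I_5) := nth 0 [:: 0; e 0; e 1; e 2%:R; const_mx 1] k.
exists (\matrix_k (s + b k)) => r rE.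
have {}rE k : r k 0 ^+ 2 = dot (b k) (b k).
  by rewrite rE rowK opprD addrA subrr add0r dotNl dotNr opprK.
have dot_e k u : dot (e k) u = u 0 k.
  rewrite dotE (bigD1 k) //= big1 ?addr0 ?mxE ?eqxx ?mul1r // => l lk.
  by rewrite mxE (negPf lk) andbF mul0r.
have dot_1 u : dot (const_mx 1) u = u 0 0 + u 0 1 + u 0 2%:R.
  rewrite dotE !big_ord_recl big_ord0 !mxE !mul1r addr0 addrA.
  by do !congr (_ + _); congr (u _ _); apply: val_inj.
have r0 : r 0 0 = 0 by apply/eqP; rewrite -sqrf_eq0 rE dot0r.
have r1 : r 1 0 ^+ 2 = 1 by rewrite rE dot_e mxE !eqxx.
have r2 : r 2%:R 0 ^+ 2 = 1 by rewrite rE dot_e mxE !eqxx.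
have r3 : r 3%:R 0 ^+ 2 = 1 by rewrite rE dot_e mxE !eqxx.
have r4 : r 4%:R 0 ^+ 2 = 3 by rewrite rE dot_1 !mxE; ring.
apply/det_matA_neq0P => x u c eq0.
have {}eq0 k : - 2 * r k 0 * x + 2 * (dot s u + dot (b k) u) - c = 0.
  by rewrite -dotDl -(eq0 k) rowK.
have cE := eq0 0; rewrite r0 dot0l in cE.
have := eq0 1; have := eq0 2%:R; have := eq0 3%:R; have := eq0 4%:R.
rewrite dot_1 !dot_e => e4 e3 e2 e1.
have u0 : u 0 0 = r 1 0 * x by lra.
have u1 : u 0 1 = r 2%:R 0 * x by lra.
have u2 : u 0 2%:R = r 3%:R 0 * x by lra.
(* Three equations give the coordinates of [u] as multiples of [x]; inserting them into that of
   microphone 4 leaves a multiple of [x], whose factor is nonzero because 3 is neither 1 nor 9. *)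
have x0 : x = 0.
  have /eqP : (r 4%:R 0 - r 1 0 - r 2%:R 0 - r 3%:R 0) * x = 0 by lra.
  rewrite mulf_eq0 => /orP[/eqP r4E|/eqP //]; exfalso.
  have {r4E}r4E : r 4%:R 0 = r 1 0 + r 2%:R 0 + r 3%:R 0 by lra.
  have sign_r (k : 'I_5) : r k 0 ^+ 2 = 1 -> r k 0 = 1 \/ r k 0 = -1.
    by move/eqP; rewrite sqrf_eq1 => /orP[]/eqP; [left | right].
  move: r4; rewrite r4E.
  by case: (sign_r _ r1) => ->; case: (sign_r _ r2) => ->; case: (sign_r _ r3) => ->; lra.
have u_eq0 : u = 0.
  apply/rowP => k; rewrite mxE; move: u0 u1 u2; rewrite x0 !mulr0.
  case: k => -[|[|[|//]]] ltk u0 u1 u2.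
  - by rewrite -u0; congr (u _ _); apply: val_inj.
  - by rewrite -u1; congr (u _ _); apply: val_inj.
  - by rewrite -u2; congr (u _ _); apply: val_inj.
by split=> //; move: cE; rewrite x0 u_eq0 dot0r; lra.
Qed.

(* matD is the Gram matrix of the vectors (a i - s, r i) for a multiple of the
   Lorentz form, hence has rank at most 4. *)
Lemma det_matD_eq0 a r s : (forall k, r k 0 ^+ 2 = dot (s - row k a) (s - row k a)) ->
  \det (matD a r) = 0.
Proof.
move=> rE; pose b : 'M[R]_(5, 3) := \matrix_k (row k a - s).
have DE : matD a r = row_mx (2 *: b) (- 2 *: r) *m (row_mx b r)^T.
  apply/matrixP => i j; rewrite matDE tr_row_mx mul_row_col !mxE big_ord1 !mxE.
  have -> : \sum_k (2 *: b) i k * b^T k j = 2 * dot (row i a - s) (row j a - s).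
    by rewrite dotE mulr_sumr; apply: eq_bigr => k _; rewrite !mxE mulrA.
  (* Expanding around [s], the squares cancel against [r i] and [r j] squared, and only the mixed
     terms remain. *)
  have := rE i; have := rE j.
  rewrite -[row i a - row j a](subrKA s) -[s - row j a]opprB -[s - row i a]opprB dotBB !(dotNl, dotNr).
  rewrite !opprK sqrrB; lra.
apply: contraTeq (mulmx_max_rank (row_mx (2 *: b) (- 2 *: r)) (row_mx b r)^T).
rewrite -DE -unitfE -unitmxE -row_free_unit => /eqP ->.
by [].
Qed.

End Geometry.

(** * Generic positions are good *)

Section GenericPositions.
Variable R : realType.
Implicit Types (a : 'M[R]_(5, 3)) (s : 'I_5 -> 'rV[R]_3) (r t : 'cV[R]_5).

Definition position_coord (k : 'I_(5 * 3)) a : R := mxvec a 0 k.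

Definition distances s a : 'cV[R]_5 := \col_i enorm (s i - row i a).

Definition signed_distances s (x : 'M[R]_(5, 3) * ('I_5 -> bool)) : 'cV[R]_5 :=
  \col_i signed_root (fun i a => enorm (s i - row i a)) i x.

(** The polynomial with all signs eliminated is nonzero because at the given position no choice of
    signs makes [g] vanish. Where it does not vanish, [g] is nonzero in particular for the choice of
    all plus signs, that is, at the true distances. *)
Lemma generic_neq0 s (g : 'M[R]_(5, 3) -> 'cV[R]_5 -> R) :
    polyfun (coordinate_or_root position_coord (fun i a => enorm (s i - row i a)) 5)
      (fun x => g x.1 (signed_distances s x)) ->
    (exists a, forall r,
      (forall k, r k 0 ^+ 2 = dot (s k - row k a) (s k - row k a)) -> g a r != 0) ->
  exists2 p : {mpoly R[5 * 3]}, p != 0 &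
    forall a, p.@[fun k => mxvec a 0 k] != 0 -> g a (distances s a) != 0.
Proof.
move=> gpoly [a0 ga0].
have [i|p pE] := sign_elimination _ gpoly.
  have -> : (fun x : 'M[R]_(5, 3) * ('I_5 -> bool) => enorm (s i - row i x.1) ^+ 2) =
      (fun x => \sum_k (s i 0 k - position_coord (mxvec_index i k) x.1) ^+ 2).
    apply/funext => x; rewrite enorm_sqr dotE; apply: eq_bigr => k _.
    by rewrite /position_coord mxvecE !mxE expr2.
  apply: polyfun_sum => k; apply/polyfun_exp/polyfun_sub; first exact: polyfun_cst.
  by apply: polyfun_gen; exists (mxvec_index i k).
exists p => [|a].
  apply/eqP => p0; have [|e ge0] := (pE a0).1; first by rewrite p0 meval0.
  have /ga0 : forall k, signed_distances s (a0, e) k 0 ^+ 2 =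
      dot (s k - row k a0) (s k - row k a0).
    by move=> k; rewrite mxE /signed_root exprMn sqrr_sign mul1r enorm_sqr.
  by rewrite ge0 eqxx.
apply: contra_neq => ga; apply/pE; exists (fun=> false); rewrite -ga; congr g.
by apply/colP => k; rewrite !mxE /signed_root expr0 mul1r.
Qed.

Section Entries.
Variable s : 'I_5 -> 'rV[R]_3.
Let gens := coordinate_or_root position_coord (fun i a => enorm (s i - row i a)) 5.

Lemma polyfun_position i k : polyfun gens (fun x => x.1 i k).
Proof.
have -> : (fun x : 'M[R]_(5, 3) * ('I_5 -> bool) => x.1 i k) =
    (fun x => position_coord (mxvec_index i k) x.1).
  by apply/funext => x; rewrite /position_coord mxvecE.
by apply: polyfun_gen; left; exists (mxvec_index i k).
Qed.

Lemma polyfun_signed_distance i : polyfun gens (fun x => signed_distances s x i 0).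
Proof.
under eq_fun => x do rewrite mxE.
by apply: polyfun_gen; right; exists i.
Qed.

Lemma polyfun_det_matD :
  polyfun gens (fun x => \det (matD x.1 (signed_distances s x))).
Proof.
apply: polyfun_det => i j; under eq_fun => x do rewrite matDE dotE.
apply: polyfun_sub.
  by apply/polyfun_exp/polyfun_sub; apply: polyfun_signed_distance.
apply: polyfun_sum => k; under eq_fun => x do rewrite !mxE -expr2.
by apply/polyfun_exp/polyfun_sub; apply: polyfun_position.
Qed.

Lemma polyfun_det_matA :
  polyfun gens (fun x => \det (matA x.1 (signed_distances s x))).
Proof.
apply: polyfun_det => i j; rewrite /matA /mattA.
under eq_fun => x do rewrite mxE.
case: (@split 1 (3 + 1) j) => k; first under eq_fun => x do rewrite mxE.
  apply: polyfun_mul; first exact: polyfun_cst.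
  rewrite ord1; exact: polyfun_signed_distance.
under eq_fun => x do rewrite mxE.
case: (@split 3 1 k) => l; under eq_fun => x do rewrite mxE; last exact: polyfun_cst.
apply: polyfun_mul; first exact: polyfun_cst.
exact: polyfun_position.
Qed.

End Entries.

End GenericPositions.

(** * Correctness of the algorithm at generic positions *)

Section Room.
Variables (R : realType) (nw : nat) (walls : 'I_nw -> wall R).
Variables (speaker : 'rV[R]_3) (hears : 'M[R]_(5, 3) -> 'I_5 -> set 'I_nw).

(** Every tuple of times comes from a tuple of mirror points. If [matD] is singular, that tuple is
    constant, so [matA] is invertible and the linear case returns the common point with time [t0];
    the quadratic and the unspecified case never arise. *)
Lemma good_of_generic (a : 'M[R]_(5, 3)) :
    (forall s : 'I_5 -> 'rV[R]_3, (forall i, mirror_points walls speaker (s i)) ->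
       if [forall i, s i == s 0] then \det (matA a (distances s a)) != 0
       else \det (matD a (distances s a)) != 0) ->
  good walls speaker hears a.
Proof.
move=> generic t0 T.
have matA_neq0 s (t : 'cV[R]_5) : mirror_points walls speaker s ->
    (forall i, t i 0 = t0 + enorm (s - row i a)) -> \det (matA a t) != 0.
  move=> Ss tE; have := generic (fun=> s) (fun=> Ss).
  rewrite (introT forallP) => [|i]; last exact: eqxx.
  by apply: det_matA_shift => i; rewrite tE mxE.
have tuple_source (t : 'cV[R]_5) : (forall i, T i (t i 0)) -> \det (matD a t) = 0 ->
    exists2 s, mirror_points walls speaker s &
               forall i, t i 0 = t0 + enorm (s - row i a).
  move=> Tt D0.
  have /choice[s sP] i : exists s, mirror_points walls speaker s /\
      t i 0 = t0 + enorm (s - row i a).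
    have [_ [k _ <-] <-] := Tt i.
    by exists (mirror_point speaker (walls k)); split=> //; exists k.
  have := generic s (fun i => (sP i).1).
  case: forallP => [s_const _|_].
    exists (s 0); first exact: (sP 0).1.
    by move=> i; rewrite (sP i).2 (eqP (s_const i)).
  (* Entries of [matD] involve only differences of times, so [t0] drops out. *)
  case/negP; rewrite -[X in _ == X]D0; apply/eqP; congr (\det _).
  apply/matrixP => i j; rewrite !matDE !mxE !(sP _).2.
  by congr (_ ^+ 2 - _); ring.
have solE s (t : 'cV[R]_5) : mirror_points walls speaker s ->
    (forall i, t i 0 = t0 + enorm (s - row i a)) ->
    \rank (matA a t) = 5%N /\ linear_solution a t = (t0, s).
  move=> Ss tE; have A_neq0 := matA_neq0 s t Ss tE; split.
    by apply/eqP; rewrite -[_ == _]/(row_free _) row_free_unit unitmxE unitfE.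
  by apply: linear_solutionE => // i; rewrite tE addrAC subrr add0r enorm_sqr.
split.
- move=> [t [Tt D0 rank_le _]]; have [s Ss tE] := tuple_source t Tt D0.
  by move: rank_le; rewrite (solE s t Ss tE).1.
- move=> s heard.
  have Ss : mirror_points walls speaker s.
    by have [k _ <-] := heard 0; exists k.
  pose t : 'cV[R]_5 := \col_i (t0 + enorm (s - row i a)).
  have tE i : t i 0 = t0 + enorm (s - row i a) by rewrite mxE.
  have [rank5 sol] := solE s t Ss tE.
  exists t; split; [by move=> i; rewrite tE; exists s | | by left].
  have -> : matD a t = matD a (distances (fun=> s) a).
    by apply/matrixP => i j; rewrite !matDE !mxE; congr (_ ^+ 2 - _); ring.
  by apply: (@det_matD_eq0 _ _ _ s) => k; rewrite mxE enorm_sqr.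
- move=> t x [tt [Tt D0]]; have [s Ss tE] := tuple_source tt Tt D0.
  have [rank5 sol] := solE s tt Ss tE.
  by case=> [[_]|[]]; rewrite ?sol ?rank5 // => -[_ ->].
Qed.

End Room.

Theorem theorem3p1 (R : realType) (nw : nat) (walls : 'I_nw -> wall R)
    (speaker : 'rV[R]_3) (hears : 'M[R]_(5, 3) -> 'I_5 -> set 'I_nw) :
  exists V : set 'rV[R]_(5 * 3),
    [/\ subvariety V, (dimension V < 15%:R%:E)%E &
        forall a : 'M[R]_(5, 3), ~ good walls speaker hears a -> V (mxvec a)].
Proof.
(* All tuples of walls are treated, whichever of them [hears] selects, so the hypersurface does not
   depend on how [hears] varies with the positions. *)
pose s (k : {ffun 'I_5 -> 'I_nw}) i := mirror_point speaker (walls (k i)).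
have /choice[p pP] (k : {ffun 'I_5 -> 'I_nw}) : exists p : {mpoly R[5 * 3]}, p != 0 /\
    forall a, p.@[fun k => mxvec a 0 k] != 0 ->
      if [forall i, s k i == s k 0] then \det (matA a (distances (s k) a)) != 0
      else \det (matD a (distances (s k) a)) != 0.
  case: forallP => [s_const|s_nconst].
    have [|p p0 pP] := @generic_neq0 _ (s k) (fun a r => \det (matA a r))
      (polyfun_det_matA (s k)); last by exists p.
    have [a aP] := exists_matA_nonsingular (s k 0).
    by exists a => r rE; apply: aP => i; rewrite rE (eqP (s_const i)).
  have [|p p0 pP] := @generic_neq0 _ (s k) (fun a r => \det (matD a r))
      (polyfun_det_matD (s k)); last by exists p.
  have /existsP[i si] : [exists i, s k i != s k 0].
    by rewrite -negb_forall; apply/forallP.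
  exact: exists_matD_nonsingular si.
pose q := \prod_k p k.
have q0 : q != 0 by apply/prodf_neq0 => k _; have [] := pP k.
exists (zero_locus [set q]); split; first by exists [set q].
  exact: dimension_hypersurface.
move=> a a_bad _ ->; apply: contrapT => /eqP qa; apply: a_bad.
apply: good_of_generic => s' Ss'.
have /choice[k kP] i : exists k, s' i = mirror_point speaker (walls k).
  by have [k _ <-] := Ss' i; exists k.
have s'E : s' = s [ffun i => k i].
  by apply/funext => i; rewrite /s ffunE.
rewrite s'E; have [_] := pP [ffun i => k i]; apply.
by apply: contraNneq qa => pa; rewrite /q (bigD1 [ffun i => k i]) //= mevalM pa mul0r.
Qed.
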